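(* Suppose $x\in(0,1)$ is fixed. Then: (a) if $0<b<1$, the function $a\mapsto I_x(a,b)$ is strictly log-convex on $(0,\infty)$; (b) if $b=1$, then $I_x(a,b)=x^a$ for all $a>0$, and so $a\mapsto I_x(a,b)$ is log-neutral (that is, its logarithm is an affine function of $a$); (c) if $b>1$, the function $a\mapsto I_x(a,b)$ is strictly log-concave on $(0,\infty)$.
   Context: For $a,b>0$ and $x\in(0,1)$, $I_x(a,b)$ denotes the normalized incomplete beta function $$I_x(a,b)=\frac{\int_0^x t^{a-1}(1-t)^{b-1}\,dt}{\int_0^1 t^{a-1}(1-t)^{b-1}\,dt}.$$ A positive function $f$ is strictly log-concave (strictly log-convex) if $\log f$ is strictly concave (strictly convex). *)

(* Defs.v *)
From HB Require Import structures.
From mathcomp Require Import all_boot all_order all_algebra.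
From mathcomp Require Import all_classical all_reals all_analysis.

Set Implicit Arguments.
Unset Strict Implicit.
Unset Printing Implicit Defensive.

Import Order.TTheory GRing.Theory Num.Theory.
Import numFieldNormedType.Exports.

Local Open Scope classical_set_scope.
Local Open Scope ring_scope.

(* The integrals below are real-valued Lebesgue integrals. They run over the
   open interval because the integrand may be singular at 0 and at 1, where
   [powR] takes conventional values. For 0 < a, 0 < b and 0 <= x <= 1 the
   integrals are finite, so the conversion from the extended reals built into
   [Rintegral] loses nothing. *)
Definition incomplete_beta (R : realType) (x a b : R) : R :=
  \int[@lebesgue_measure R]_(t in `]0, x[) (t `^ (a - 1) * (1 - t) `^ (b - 1)).

Definition normalized_incomplete_beta (R : realType) (x a b : R) : R :=
  incomplete_beta x a b / incomplete_beta 1 a b.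

Definition strictly_convex_on (R : realType) (D : set R) (f : R -> R) : Prop :=
  forall u v t : R, D u -> D v -> u != v -> 0 < t -> t < 1 ->
    f (t * u + (1 - t) * v) < t * f u + (1 - t) * f v.

Definition strictly_concave_on (R : realType) (D : set R) (f : R -> R) : Prop :=
  forall u v t : R, D u -> D v -> u != v -> 0 < t -> t < 1 ->
    t * f u + (1 - t) * f v < f (t * u + (1 - t) * v).

Definition affine_on (R : realType) (D : set R) (f : R -> R) : Prop :=
  exists c d : R, forall u : R, D u -> f u = c * u + d.

(* [ln] is 0 on nonpositive reals, so positivity on D has to be required
   explicitly in the logarithmic notions. *)
Definition positive_on (R : realType) (D : set R) (f : R -> R) : Prop :=
  forall u : R, D u -> 0 < f u.

Definition strictly_log_convex_on (R : realType) (D : set R) (f : R -> R) :=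
  positive_on D f /\ strictly_convex_on D (fun u => ln (f u)).

Definition strictly_log_concave_on (R : realType) (D : set R) (f : R -> R) :=
  positive_on D f /\ strictly_concave_on D (fun u => ln (f u)).

Definition log_neutral_on (R : realType) (D : set R) (f : R -> R) :=
  positive_on D f /\ affine_on D (fun u => ln (f u)).

(* Main.v *)
Require Import Defs.
From mathcomp Require Import all_boot all_order all_algebra.
From mathcomp Require Import ring lra.
From mathcomp Require Import all_classical all_reals all_analysis.
From mathcomp Require Import measurable_realfun.
Import Order.TTheory GRing.Theory Num.Theory.
Import numFieldNormedType.Exports.
Local Open Scope classical_set_scope.
Local Open Scope ring_scope.

(** Write [N a x] for the incomplete beta integral [incomplete_beta x a b] and
    [rho a x = x * N'(x) / N], the logarithmic derivative in [x]. It satisfies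
    the Riccati equation [x * rho' = rho * (a - h - rho)], where
    [h x = (b - 1) * x / (1 - x)]. Each required inequality on [rho] says that a
    function vanishing at [0+] has a derivative of the sign of [b - 1]:
    successively, [rho] lies strictly between [a - h] and [a] (so it tends to [a]
    at [0+]), [rho u - rho v] is on a definite side of [u - v], and [rho] is
    strictly convex or concave in [a]. The last fact makes the convexity gap
    [p ln (N u x) + q ln (N v x) - ln (N w x)], with [w = p u + q v], strictly
    monotone in [x]; comparing its values at [x] and at [1] gives the claim for
    the normalized function. *)

(** * Strict monotonicity from the sign of a derivative, with one-sided limits at the ends *)

Section monotonicity.
Context {R : realType}.
Implicit Types (f df : R -> R) (a b l x y : R).

Lemma is_derive_gt0_lt f df a b :
  (forall x, a < x -> x < b -> is_derive x 1 f (df x)) ->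
  (forall x, a < x -> x < b -> 0 < df x) ->
  forall x y, a < x -> x < y -> y < b -> f x < f y.
Proof.
move=> fdf df0 x y ax xy yb.
have itvP z : z \in `]a, b[ -> is_derive z 1 f (df z) /\ 0 < df z.
  by rewrite in_itv/= => /andP[az zb]; split; [exact: fdf|exact: df0].
apply: (@gtr0_derive1_lt_oo _ f a b) => //; last 2 first.
- by rewrite in_itv/= ax (lt_trans xy).
- by rewrite in_itv/= yb (lt_trans ax).
- by move=> z /itvP[fz _]; exact: ex_derive.
- by move=> z /itvP[fz dz]; rewrite derive1E derive_val.
- move=> z; rewrite inE => /itvP[fz _].
  by apply/differentiable_continuous/derivable1_diffP/ex_derive.
Qed.

Lemma is_derive_gt0_lt_at_left f df a b l :
  (forall x, a < x -> x < b -> is_derive x 1 f (df x)) ->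
  (forall x, a < x -> x < b -> 0 < df x) ->
  f x @[x --> b^'-] --> l -> forall x, a < x -> x < b -> f x < l.
Proof.
move=> fdf df0 fl x ax xb.
(* Limits preserve only weak inequalities: strictness is gained between [x] and the midpoint, and
   the limit is then compared with the value at the midpoint. *)
have mid : x < (x + b) / 2 /\ (x + b) / 2 < b by split; lra.
apply: (@lt_le_trans _ _ (f ((x + b) / 2))).
  by apply: (is_derive_gt0_lt _ _ _ _ fdf df0) => //; case: mid.
apply: (cvgr_to_ge fl).
near=> y; apply/ltW/(is_derive_gt0_lt _ _ _ _ fdf df0) => //; lra.
Unshelve. all: by end_near. Qed.

Lemma is_derive_gt0_lt_at_right f df a b l :
  (forall x, a < x -> x < b -> is_derive x 1 f (df x)) ->
  (forall x, a < x -> x < b -> 0 < df x) ->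
  f x @[x --> a^'+] --> l -> forall x, a < x -> x < b -> l < f x.
Proof.
move=> fdf df0 fl x ax xb.
have mid : a < (a + x) / 2 /\ (a + x) / 2 < x by split; lra.
apply: (@le_lt_trans _ _ (f ((a + x) / 2))); last first.
  by apply: (is_derive_gt0_lt _ _ _ _ fdf df0) => //; case: mid.
apply: (cvgr_to_le fl).
near=> y; apply/ltW/(is_derive_gt0_lt _ _ _ _ fdf df0) => //; lra.
Unshelve. all: by end_near. Qed.

(** By the mean value theorem [f] agrees with the constant [f x] to the right of [a], and limits are
    unique. *)
Lemma is_derive_eq0_at_right f a b l :
  (forall x, a < x -> x < b -> is_derive x 1 f 0) ->
  f x @[x --> a^'+] --> l -> forall x, a < x -> x < b -> f x = l.
Proof.
move=> fdf fl x ax xb.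
suff : f y @[y --> a^'+] --> f x by move=> /(cvg_unique _ fl) ->.
apply: cvg_near_cst; near=> y.
have ay : a < y by [].
have yx : y < x by near: y; exact: nbhs_right_lt.
have fD z : z \in `]y, x[ -> is_derive z 1 f 0.
  by rewrite in_itv/= => /andP[yz zx]; apply: fdf; lra.
have fc : {within `[y, x], continuous f}.
  apply: continuous_in_subspaceT => z; rewrite inE/= in_itv/= => /andP[yz zx].
  apply/differentiable_continuous/derivable1_diffP.
  by have /@ex_derive : is_derive z 1 f 0 by apply: fdf; lra.
by have [c _] := MVT yx fD fc; rewrite mul0r => /eqP; rewrite subr_eq0 => /eqP.
Unshelve. all: by end_near. Qed.

End monotonicity.

(** Handles integrands that are singular at an endpoint. On compact subintervals [S n] exhausting
    []a, b[], the fundamental theorem bounds the integral by [M + M]; monotone convergence passes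
    the bound to the union. *)
Lemma bounded_primitive_integrable {R : realType} (f F : R -> R) (a b M : R) :
  a < b ->
  (forall x, a < x -> x < b -> is_derive x 1 F (f x)) ->
  (forall x, a < x -> x < b -> {for x, continuous f}) ->
  (forall x, a < x -> x < b -> 0 <= f x) ->
  (forall x, a < x -> x < b -> `|F x| <= M) ->
  (@lebesgue_measure R).-integrable `]a, b[ (EFin \o f).
Proof.
move=> ab Ff fc f0 FM.
(* The shift by 3 gives [e n + e n < b - a] already at [n = 0], so every [S n] is a nondegenerate
   interval. *)
pose e (n : nat) : R := (b - a) / n.+3%:R.
have e_gt0 n : 0 < e n by rewrite divr_gt0// subr_gt0.
have e_lt n : e n + e n < b - a.
  have n3 : (3 : R) <= n.+3%:R by rewrite ler_nat.
  have : e n * n.+3%:R = b - a by rewrite /e mulfVK.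
  have := e_gt0 n; nra.
have e_le m n : (m <= n)%N -> e n <= e m.
  by move=> mn; rewrite ler_pM2l ?subr_gt0// lef_pV2 ?posrE// ler_nat.
pose S n : set R := `[a + e n, b - e n]%classic.
have Sab n x : S n x -> a < x /\ x < b.
  by rewrite /S/= in_itv/= => /andP[]; have := e_gt0 n; split; lra.
have mf : measurable_fun `]a, b[ f.
  apply: open_continuous_measurable_fun => // x.
  by rewrite inE/= in_itv/= => /andP[]; exact: fc.
have mS n : measurable (S n) by exact: measurable_itv.
have mSf n : measurable_fun (S n) (EFin \o f).
  apply/measurable_EFinP; apply: measurable_funS mf => // x /Sab[ax xb].
  by rewrite /= in_itv/= ax.
have SE : \bigcup_n S n = `]a, b[%classic.
  apply/seteqP; split=> [x [n _ /Sab[ax xb]]|x]; rewrite /= in_itv/= ?ax//.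
  move=> /andP[ax xb].
  have d0 : 0 < Num.min (x - a) (b - x) / (b - a).
    by rewrite divr_gt0 ?subr_gt0// lt_min !subr_gt0 ax.
  have [n _ /(_ n.+2)] := near_infty_natSinv_lt (PosNum d0).
  rewrite /= => /(_ (leq_trans (leqnSn _) (leqnSn _))) ne.
  exists n => //; rewrite /S/= in_itv/=.
  have : e n < Num.min (x - a) (b - x).
    by rewrite /e mulrC -ltr_pdivlMr ?subr_gt0.
  by rewrite lt_min => /andP[h1 h2]; apply/andP; split; lra.
have ndS : nondecreasing_seq S.
  move=> m n mn; rewrite subsetEset => x; rewrite /S/= !in_itv/= => /andP[h1 h2].
  by have := e_le _ _ mn => en; apply/andP; split; lra.
have f0S n x : S n x -> (0 <= (EFin \o f) x)%E.
  by move=> /Sab[ax xb]; rewrite lee_fin f0.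
apply/integrableP; split; first exact/measurable_EFinP.
rewrite (_ : (\int[_]_(x in _) _)%E =
    (\int[@lebesgue_measure R]_(x in \bigcup_n S n) (f x)%:E)%E); last first.
  rewrite SE; apply: eq_integral => x; rewrite inE/= in_itv/= => /andP[ax xb].
  by rewrite ger0_norm// f0.
apply: (@le_lt_trans _ _ (M + M)%:E); last exact: ltry.
have Scvg := @ge0_nondecreasing_set_cvg_integral _ (measurableTypeR R) R S (EFin \o f)
  (@lebesgue_measure R) ndS mS mSf f0S.
apply: (cvge_to_le Scvg).
apply: nearW => n.
have Fc x : a < x -> x < b -> {for x, continuous F}.
  move=> ax xb; apply/differentiable_continuous/derivable1_diffP.
  by have /@ex_derive := Ff _ ax xb.
have lt_ab : a + e n < b - e n by have := e_lt n; lra.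
have := e_gt0 n => en0.
rewrite (@continuous_FTC2 _ f F)//.
- rewrite -EFinB lee_fin; apply: le_trans (ler_norm _) _.
  by apply: le_trans (ler_normB _ _) _; apply: lerD; apply: FM; lra.
- by apply: continuous_in_subspaceT => x; rewrite inE => /Sab[]; exact: fc.
- split.
  + move=> x; rewrite in_itv/= => /andP[h1 h2].
    by have /@ex_derive : is_derive x 1 F (f x) by apply: Ff; lra.
  + by apply: cvg_at_right_filter; apply: Fc; lra.
  + by apply: cvg_at_left_filter; apply: Fc; lra.
- move=> x; rewrite in_itv/= => /andP[h1 h2].
  have Fx : is_derive x 1 F (f x) by apply: Ff; lra.
  by rewrite derive1E derive_val.
Qed.

(** * Regularity and integrability of the beta integrand *)

Section beta_integrand.
Context {R : realType}.
Implicit Types a b c r t x y : R.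

Definition beta_integrand a b t := t `^ (a - 1) * (1 - t) `^ (b - 1).

Lemma is_derive_powR_onem b x : x < 1 ->
  is_derive x 1 (fun t => (1 - t) `^ b) (- (b * (1 - x) `^ (b - 1))).
Proof.
move=> x1; have x1_gt0 : 0 < 1 - x by rewrite subr_gt0.
have dg : is_derive x 1 (fun t : R => 1 - t) (-1).
  apply: (is_derive_eq (is_deriveB (is_derive_cst _ _ _) (is_derive_id _ _))).
  by rewrite sub0r.
have := is_derive1_comp (f := fun y : R => y `^ b) (g := fun t => 1 - t)
  (is_derive1_powR b x1_gt0) dg.
by rewrite mulrN1.
Qed.

Lemma continuous_powR b x : 0 < x -> {for x, continuous (fun t : R => t `^ b)}.
Proof.
move=> x0; apply/differentiable_continuous/derivable1_diffP.
by have /@ex_derive := @is_derive1_powR _ b x x0.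
Qed.

Lemma continuous_powR_onem b x : x < 1 ->
  {for x, continuous (fun t => (1 - t) `^ b)}.
Proof.
move=> x1; apply/differentiable_continuous/derivable1_diffP.
by have /@ex_derive := is_derive_powR_onem b x x1.
Qed.

Lemma continuous_beta_integrand a b x : 0 < x -> x < 1 ->
  {for x, continuous (beta_integrand a b)}.
Proof.
move=> x0 x1; apply: cvgM; first exact: (continuous_powR (a - 1) x x0).
exact: (continuous_powR_onem (b - 1) x x1).
Qed.

Lemma beta_integrand_gt0 a b x : 0 < x -> x < 1 -> 0 < beta_integrand a b x.
Proof. by move=> x0 x1; rewrite mulr_gt0// powR_gt0// subr_gt0. Qed.

Lemma powR_le1 r t : 0 <= r -> 0 <= t -> t <= 1 -> t `^ r <= 1.
Proof.
move=> r0 t0 t1; apply: (@le_trans _ _ (1 `^ r)); last by rewrite powR1.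
by rewrite ge0_ler_powR ?nnegrE.
Qed.

(** For [r >= 0] the power is at most 1; for [r < 0] it decreases in [t], so its value at 1/2
    dominates. The sum covers both signs of the exponent. *)
Lemma powR_half_bound r t : 2^-1 <= t -> t <= 1 -> t `^ r <= 1 + 2^-1 `^ r.
Proof.
move=> t2 t1; have t0 : 0 < t by lra.
have [r0|r0] := leP 0 r.
  apply: (@le_trans _ _ 1); last by rewrite lerDl powR_ge0.
  by rewrite powR_le1// ltW.
apply: (@le_trans _ _ (2^-1 `^ r)); last by rewrite lerDr.
rewrite -(opprK r) 2!(powRN _ (- r)) lef_pV2 ?posrE ?powR_gt0//.
by rewrite ge0_ler_powR ?nnegrE//; lra.
Qed.

Lemma integrable_powR_01 a : 0 < a ->
  (@lebesgue_measure R).-integrable `]0, 1[ (EFin \o (fun t : R => t `^ (a - 1))).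
Proof.
move=> a0.
apply: (@bounded_primitive_integrable R (fun t => t `^ (a - 1))
  (fun t => a^-1 * t `^ a) 0 1 a^-1 ltr01).
- move=> x x0 _; apply: (is_derive_eq (is_deriveZ a^-1 (is_derive1_powR a x0))).
  by rewrite /GRing.scale/=; field; rewrite gt_eqF.
- by move=> x x0 _; exact: continuous_powR.
- by move=> x _ _; rewrite powR_ge0.
- move=> x x0 x1; rewrite ger0_norm ?mulr_ge0 ?invr_ge0 ?powR_ge0 ?(ltW a0)//.
  rewrite ger_pMr ?invr_gt0// powR_le1//; lra.
Qed.

Lemma integrable_powR_onem_01 b : 0 < b ->
  (@lebesgue_measure R).-integrable `]0, 1[
    (EFin \o (fun t => (1 - t) `^ (b - 1))).
Proof.
move=> b0.
apply: (@bounded_primitive_integrable R (fun t => (1 - t) `^ (b - 1))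
  (fun t => - b^-1 * (1 - t) `^ b) 0 1 b^-1 ltr01).
- move=> x _ x1.
  apply: (is_derive_eq (is_deriveZ (- b^-1) (is_derive_powR_onem b x x1))).
  by rewrite /GRing.scale/=; field; rewrite gt_eqF.
- by move=> x _ x1; exact: continuous_powR_onem.
- by move=> x _ _; rewrite powR_ge0.
- move=> x x0 x1.
  rewrite mulNr normrN ger0_norm ?mulr_ge0 ?invr_ge0 ?powR_ge0 ?(ltW b0)//.
  rewrite ger_pMr ?invr_gt0// powR_le1//; lra.
Qed.

(** On each half of []0, 1[] only one factor can be singular and the other is at most [C], so the
    product is dominated by [C] times the sum of the two factors, each integrable. *)
Lemma integrable_beta_integrand a b : 0 < a -> 0 < b ->
  (@lebesgue_measure R).-integrable `]0, 1[ (EFin \o beta_integrand a b).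
Proof.
move=> a0 b0.
pose C := 1 + 2^-1 `^ (a - 1) + 2^-1 `^ (b - 1).
pose f1 t := t `^ (a - 1); pose f2 t := (1 - t) `^ (b - 1).
pose g t := C * (f1 t + f2 t).
have gi : (@lebesgue_measure R).-integrable `]0, 1[ (EFin \o g).
  have f12i : (@lebesgue_measure R).-integrable `]0, 1[
      ((EFin \o f1) \+ (EFin \o f2))%E.
    by apply: integrableD => //; [exact: integrable_powR_01|
      exact: integrable_powR_onem_01].
  by have := integrableZl _ C f12i; exact.
have mf : measurable_fun `](0 : R), (1 : R)[ (beta_integrand a b).
  apply: open_continuous_measurable_fun => // x.
  by rewrite inE/= in_itv/= => /andP[]; exact: continuous_beta_integrand.
apply: (le_integrable _ _ _ gi) => //; first exact/measurable_EFinP.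
move=> t; rewrite /= in_itv/= => /andP[t0 t1].
have t1' : 0 < 1 - t by rewrite subr_gt0.
rewrite lee_fin !ger0_norm ?(ltW (beta_integrand_gt0 _ _ _ _ _))//; last first.
  by rewrite mulr_ge0 ?addr_ge0 ?powR_ge0.
rewrite /g /beta_integrand /C /f1 /f2.
have : 0 < t `^ (a - 1) by rewrite powR_gt0.
have : 0 < (1 - t) `^ (b - 1) by rewrite powR_gt0.
have : 0 < (2^-1 : R) `^ (b - 1) by rewrite powR_gt0.
have : 0 < (2^-1 : R) `^ (a - 1) by rewrite powR_gt0.
(* On the left half the factor in [1 - t] is the bounded one, on the right half the factor in
   [t]. *)
have [t2|t2] := leP t 2^-1.
  have := powR_half_bound (b - 1) (1 - t).
  have -> : 2^-1 <= 1 - t by lra.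
  have -> : 1 - t <= 1 by lra.
  by move=> /(_ isT isT); nra.
have := powR_half_bound (a - 1) t (ltW t2) (ltW t1); nra.
Qed.

End beta_integrand.

(** * The incomplete beta integral as a function of its upper limit *)

Section incomplete_beta.
Context {R : realType}.
Variables a b : R.
Hypotheses (a_gt0 : 0 < a) (b_gt0 : 0 < b).
Notation mu := (@lebesgue_measure R).

Let integrable_beta_integrand_cc :
  mu.-integrable `[0, 1] (EFin \o beta_integrand a b).
Proof.
have /integrableP[mf fi] := integrable_beta_integrand a b a_gt0 b_gt0.
apply/integrableP; split; first exact: emeasurable_fun_itv_cc mf.
by rewrite integral_itv_bndoo//; exact: measurableT_comp mf.
Qed.

(** Endpoints are negligible, so the integral takes the closed-interval form to which the
    fundamental theorem applies; [x <= 1] keeps the domain where measurability is known. *)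
Let incomplete_betaE x : x <= 1 ->
  incomplete_beta x a b = parameterized_integral mu 0 x (beta_integrand a b).
Proof.
move=> x1; rewrite /incomplete_beta /parameterized_integral /Rintegral.
rewrite [in RHS]integral_itv_bndoo//.
have /integrableP[mf _] := integrable_beta_integrand a b a_gt0 b_gt0.
by apply: measurable_funS mf => //; apply: subset_itvl; rewrite bnd_simp.
Qed.

Lemma is_derive_incomplete_beta (x : R) : 0 < x -> x < 1 ->
  is_derive x 1 (fun y => incomplete_beta y a b) (beta_integrand a b x).
Proof.
move=> x0 x1.
apply: (near_eq_is_derive
  (f := fun y => parameterized_integral mu 0 y (beta_integrand a b))).
  near=> y; apply/esym/incomplete_betaE.
  by near: y; exact: lt_le_nbhsl.
have [d dE] := continuous_FTC1_closed x1 integrable_beta_integrand_cc x0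
  (continuous_beta_integrand a b x x0 x1).
by split; [exact: d|rewrite -derive1E dE].
Unshelve. all: by end_near. Qed.

Lemma cvg_incomplete_beta_0 : incomplete_beta x a b @[x --> 0^'+] --> 0.
Proof.
have /cvg_at_right_filter :=
  parameterized_integral_cvg_left (@ltr01 R) integrable_beta_integrand_cc.
apply: cvg_trans; apply: near_eq_cvg; near=> x.
by rewrite incomplete_betaE//; near: x; exact: nbhs_right_le.
Unshelve. all: by end_near. Qed.

Lemma cvg_incomplete_beta_1 :
  incomplete_beta x a b @[x --> 1^'-] --> incomplete_beta 1 a b.
Proof.
rewrite (incomplete_betaE 1 (lexx _)).
have := parameterized_integral_cvg_at_left (@ltr01 R) integrable_beta_integrand_cc.
apply: cvg_trans; apply: near_eq_cvg; near=> x.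
by rewrite incomplete_betaE.
Unshelve. all: by end_near. Qed.

Lemma incomplete_beta_gt0 (x : R) : 0 < x -> x <= 1 -> 0 < incomplete_beta x a b.
Proof.
have lt1 (y : R) : 0 < y -> y < 1 -> 0 < incomplete_beta y a b.
  apply: (is_derive_gt0_lt_at_right _ _ _ _ _ _ _ cvg_incomplete_beta_0).
    exact: is_derive_incomplete_beta.
  exact: beta_integrand_gt0.
move=> x0; rewrite le_eqVlt => /predU1P[->|]; last exact: lt1.
(* The derivative is known only inside []0, 1[], so the value at 1 is reached as a left limit, which
   exceeds the positive value at 1/2. *)
have h : 0 < (2^-1 : R) /\ 2^-1 < (1 : R) by split; lra.
apply: (lt_trans (lt1 _ h.1 h.2)).
apply: (is_derive_gt0_lt_at_left _ _ _ _ _ _ _ cvg_incomplete_beta_1 _ h.1 h.2).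
  exact: is_derive_incomplete_beta.
exact: beta_integrand_gt0.
Qed.

End incomplete_beta.

(** The difference [f] of the two sides has zero derivative on []0, 1[] and limit 0 at [0+], hence
    vanishes there; left continuity extends this to 1. *)
Lemma incomplete_beta_b1 {R : realType} (a x : R) : 0 < a -> 0 < x -> x <= 1 ->
  incomplete_beta x a 1 = x `^ a / a.
Proof.
move=> a0 x0.
pose f y := incomplete_beta y a 1 - a^-1 * y `^ a.
have f0 (y : R) : 0 < y -> y < 1 -> f y = 0.
  apply: is_derive_eq0_at_right => [{}y y0 y1|].
    apply: (is_derive_eq (is_deriveB
      (is_derive_incomplete_beta a 1 a0 ltr01 y y0 y1)
      (is_deriveZ a^-1 (is_derive1_powR a y0)))).
    rewrite /beta_integrand subrr powRr0 mulr1 /GRing.scale/=.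
    by field; rewrite gt_eqF.
  rewrite -[0 in X in _ --> X](subrr 0) -[X in _ --> _ - X](mulr0 a^-1).
  apply: cvgB; first exact: cvg_incomplete_beta_0.
  by apply: cvgMr; exact: powR_cvg0.
have fE y : f y = 0 -> incomplete_beta y a 1 = y `^ a / a.
  by rewrite /f => /subr0_eq ->; rewrite mulrC.
rewrite le_eqVlt => /predU1P[->|x1]; last exact/fE/f0.
apply: fE; rewrite /f.
have f1 : f y @[y --> 1^'-] --> f 1.
  apply: cvgB; first exact: cvg_incomplete_beta_1.
  apply: cvgMr; apply: cvg_at_left_filter; exact: continuous_powR.
apply: (cvg_unique _ f1) => //.
apply: cvg_near_cst; near=> y; apply: f0 => //.
Unshelve. all: by end_near. Qed.

(** * The logarithmic derivative [rho] and its dependence on [a] *)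

Section incomplete_beta_log_derivative.
Context {R : realType}.
Variable b : R.
Hypotheses (b_gt0 : 0 < b) (b_neq1 : b != 1).
Implicit Types a u v p q x : R.

Let N a x := incomplete_beta x a b.
(** For [0 < x < 1] this is [x * N'(x)], the numerator of [rho]. *)
Let weight a x := x `^ a * (1 - x) `^ (b - 1).
Let rho a x := weight a x / N a x.
Let h x := (b - 1) * x / (1 - x).

(** Inequalities whose direction depends on the sign of [b - 1] are stated with that factor, which
    treats both cases at once. In the first two, [rho_lt] and [rho_gt], the derivative carries the
    square of this factor. *)
Let sqr_gt0 : 0 < (b - 1) ^+ 2.
Proof. by rewrite exprn_even_gt0//= subr_eq0. Qed.

Let N_gt0 a x : 0 < a -> 0 < x -> x < 1 -> 0 < N a x.
Proof. by move=> a0 x0 /ltW; exact: incomplete_beta_gt0. Qed.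

Let weight_gt0 a x : 0 < x -> x < 1 -> 0 < weight a x.
Proof. by move=> x0 x1; rewrite mulr_gt0 ?powR_gt0// subr_gt0. Qed.

Let rho_gt0 a x : 0 < a -> 0 < x -> x < 1 -> 0 < rho a x.
Proof. by move=> a0 x0 x1; rewrite divr_gt0 ?weight_gt0 ?N_gt0. Qed.

Let weightE a x : 0 < a -> 0 < x -> x < 1 -> weight a x = N a x * rho a x.
Proof. by move=> a0 x0 x1; rewrite /rho mulrCA divff ?mulr1// gt_eqF// N_gt0. Qed.

Let powRB1 (c y : R) : 0 < y -> y `^ (c - 1) = y `^ c / y.
Proof.
move=> y0; rewrite powRB ?powRr1 ?(ltW y0)//.
by apply/implyP => _; rewrite gt_eqF.
Qed.

Let is_derive_N a x : 0 < a -> 0 < x -> x < 1 ->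
  is_derive x 1 (N a) (N a x * rho a x / x).
Proof.
move=> a0 x0 x1; apply: (is_derive_eq (is_derive_incomplete_beta a b a0 b_gt0 x x0 x1)).
by rewrite -weightE// /beta_integrand /weight powRB1//; ring.
Qed.

(** Logarithmic differentiation: [x * weight' / weight] gets [a] from the power of [x] and [- h x]
    from the power of [1 - x]. *)
Let is_derive_weight a x : 0 < x -> x < 1 ->
  is_derive x 1 (weight a) (weight a x * (a - h x) / x).
Proof.
move=> x0 x1; have x1' : 0 < 1 - x by rewrite subr_gt0.
apply: (is_derive_eq (is_deriveM (is_derive1_powR a x0)
  (is_derive_powR_onem (b - 1) x x1))).
rewrite /weight /h /GRing.scale/= (powRB1 a)// (powRB1 (b - 1))//.
by field; rewrite !gt_eqF.
Qed.

Let is_derive_rho a x : 0 < a -> 0 < x -> x < 1 ->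
  is_derive x 1 (rho a) (rho a x * (a - h x - rho a x) / x).
Proof.
move=> a0 x0 x1; have N0 := N_gt0 a x a0 x0 x1.
have N_neq0 : N a x != 0 by rewrite gt_eqF.
apply: (is_derive_eq (is_deriveM (is_derive_weight a x x0 x1)
  (is_deriveV N_neq0 (is_derive_N a x a0 x0 x1)))).
rewrite /= /GRing.scale/= weightE//; set r := rho a x.
by field; rewrite N_neq0 gt_eqF.
Qed.

Let cvg_N_0 a : 0 < a -> N a x @[x --> 0^'+] --> 0.
Proof. by move=> a0; exact: cvg_incomplete_beta_0. Qed.

Let cvg_weight_0 a : 0 < a -> weight a x @[x --> 0^'+] --> 0.
Proof.
move=> a0; rewrite -[X in _ --> X](mul0r ((1 - 0) `^ (b - 1))).
apply: cvgM; first exact: powR_cvg0.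
by apply: cvg_at_right_filter; exact: continuous_powR_onem.
Qed.

(** Multiplying by [N] clears the quotient. In the derivative of [a * N - weight] the terms in [a]
    cancel, leaving [weight * h / x], which has the sign of [b - 1]. *)
Let rho_lt a x : 0 < a -> 0 < x -> x < 1 -> 0 < (b - 1) * (a - rho a x).
Proof.
move=> a0; move: x.
pose f x := (b - 1) * (a * N a x - weight a x).
have f_gt0 x : 0 < x -> x < 1 -> 0 < f x.
  apply: (is_derive_gt0_lt_at_right f
    (fun x => (b - 1) ^+ 2 * (N a x * rho a x / (1 - x))) 0 1 0).
  - move=> {}x x0 x1.
    apply: (is_derive_eq (is_deriveZ (b - 1) (is_deriveB
      (is_deriveZ a (is_derive_N a x a0 x0 x1)) (is_derive_weight a x x0 x1)))).
    rewrite /= /GRing.scale/= weightE// /h; field.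
    by rewrite !gt_eqF// subr_gt0.
  - move=> {}x x0 x1.
    by rewrite mulr_gt0// divr_gt0 ?subr_gt0// mulr_gt0 ?N_gt0 ?rho_gt0.
  - have l0 : (b - 1) * (a * 0 - 0) = 0 by ring.
    rewrite -[X in _ --> X]l0.
    apply: cvgMr; apply: cvgB; last exact: cvg_weight_0.
    by apply: cvgMr; exact: cvg_N_0.
move=> x x0 x1; have := f_gt0 x x0 x1.
have -> : f x = N a x * ((b - 1) * (a - rho a x)) by rewrite /f weightE//; ring.
by rewrite pmulr_rgt0// N_gt0.
Qed.

Let cvg_h_0 : h x @[x --> 0^'+] --> 0.
Proof.
have l0 : h 0 = 0 by rewrite /h mulr0 mul0r.
rewrite -[X in _ --> X]l0.
apply: cvg_at_right_filter; apply: cvgM; first by apply: cvgMr; exact: cvg_id.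
by apply: cvgV; [rewrite subr0|apply: cvgB; [exact: cvg_cst|exact: cvg_id]].
Qed.

(** In the derivative of [weight + (h - a) * N] the terms in [rho] cancel, leaving [h' * N], which
    has the sign of [b - 1]. *)
Let rho_gt a x : 0 < a -> 0 < x -> x < 1 -> 0 < (b - 1) * (rho a x + h x - a).
Proof.
move=> a0; move: x.
pose f x := (b - 1) * (weight a x + (h x - a) * N a x).
have dh x : 0 < x -> x < 1 -> is_derive x 1 h ((b - 1) / (1 - x) ^+ 2).
  move=> x0 x1; have x1' : 1 - x != 0 by rewrite gt_eqF// subr_gt0.
  have donem : is_derive x 1 (fun t : R => 1 - t) (-1).
    apply: (is_derive_eq (is_deriveB (is_derive_cst _ _ _) (is_derive_id _ _))).
    by rewrite sub0r.
  apply: (is_derive_eq (is_deriveM (is_deriveZ (b - 1) (is_derive_id x 1))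
    (is_deriveV (f := fun t => 1 - t) x1' donem))).
  by rewrite /= /GRing.scale/=; field.
have f_gt0 x : 0 < x -> x < 1 -> 0 < f x.
  apply: (is_derive_gt0_lt_at_right f
    (fun x => (b - 1) ^+ 2 * (N a x / (1 - x) ^+ 2)) 0 1 0).
  - move=> {}x x0 x1.
    apply: (is_derive_eq (is_deriveZ (b - 1) (is_deriveD
      (is_derive_weight a x x0 x1) (is_deriveM
      (is_deriveB (dh x x0 x1) (is_derive_cst a x 1)) (is_derive_N a x a0 x0 x1))))).
    rewrite /= /GRing.scale/= weightE//.
    have -> : (h - cst a) x = h x - a by [].
    by field; rewrite !gt_eqF// subr_gt0.
  - move=> {}x x0 x1.
    by rewrite mulr_gt0// divr_gt0 ?N_gt0// exprn_gt0// subr_gt0.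
  - have l0 : (b - 1) * (0 + (0 - a) * 0) = 0 by ring.
    rewrite -[X in _ --> X]l0.
    apply: cvgMr; apply: cvgD; first exact: cvg_weight_0.
    apply: cvgM; last exact: cvg_N_0.
    apply: cvgB; [exact: cvg_h_0|exact: cvg_cst].
move=> x x0 x1; have := f_gt0 x x0 x1.
have -> : f x = N a x * ((b - 1) * (rho a x + h x - a)) by rewrite /f weightE//; ring.
by rewrite pmulr_rgt0// N_gt0.
Qed.

(** Squeeze between [a - h x] and [a]. The factor [b - 1] fixes the order of the two bounds and is
    divided out at the end. *)
Let cvg_rho_0 a : 0 < a -> rho a x @[x --> 0^'+] --> a.
Proof.
move=> a0.
have b1 : b - 1 != 0 by rewrite subr_eq0.
have : (b - 1) * rho a x @[x --> 0^'+] --> (b - 1) * a.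
  apply: (@squeeze_cvgr _ _ _ _ (fun x => (b - 1) * (a - h x)) (fun=> (b - 1) * a)).
  - near=> x.
    have x0 : 0 < x by [].
    have x1 : x < 1 by near: x; exact: nbhs_right_lt.
    have := rho_lt a x a0 x0 x1; have := rho_gt a x a0 x0 x1.
    by move=> h1 h2; apply/andP; split; lra.
  - have l0 : (b - 1) * (a - 0) = (b - 1) * a by ring.
    rewrite -[X in _ --> X]l0.
    by apply: cvgMr; apply: cvgB; [exact: cvg_cst|exact: cvg_h_0].
  - exact: cvg_cst.
move=> /(cvgMr (a := (b - 1)^-1)); rewrite mulKf//; apply: cvg_trans.
apply: near_eq_cvg; near=> x.
by rewrite /= mulKf.
Unshelve. all: by end_near. Qed.

(** As [weight u x] is [x^(u - v)] times [weight v x], the claim is [N u x < x^(u - v) * N v x].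
    Differentiating the difference leaves only the term from the power, positive for either sign of
    [b - 1]. *)
Let rho_mono u v x : 0 < v -> v < u -> 0 < x -> x < 1 -> rho v x < rho u x.
Proof.
move=> v0 vu; have u0 := lt_trans v0 vu; move: x.
pose f x := x `^ (u - v) * N v x - N u x.
have weightD x : 0 < x -> weight u x = x `^ (u - v) * weight v x.
  move=> x0; rewrite /weight mulrA -powRD ?subrK//.
  by apply/implyP => _; rewrite gt_eqF.
have f_gt0 x : 0 < x -> x < 1 -> 0 < f x.
  apply: (is_derive_gt0_lt_at_right f
    (fun x => (u - v) * (x `^ (u - v) / x) * N v x) 0 1 0).
  - move=> {}x x0 x1.
    apply: (is_derive_eq (is_deriveB (is_deriveM (is_derive1_powR (u - v) x0)
      (is_derive_N v x v0 x0 x1)) (is_derive_N u x u0 x0 x1))).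
    rewrite /= /GRing.scale/= (powRB1 (u - v) x x0).
    move: (weightE v x v0 x0 x1) (weightE u x u0 x0 x1); rewrite (weightD x x0).
    move: (N v x) (rho v x) (N u x) (rho u x) (weight v x) => nv rv nu ru wv E1 E2.
    by rewrite -E2 E1; field; rewrite gt_eqF.
  - move=> {}x x0 x1.
    by rewrite mulr_gt0 ?N_gt0// mulr_gt0 ?subr_gt0// divr_gt0// powR_gt0.
  - have l0 : 0 * 0 - 0 = 0 :> R by ring.
    rewrite -[X in _ --> X]l0.
    apply: cvgB; last exact: cvg_N_0.
    by apply: cvgM; [apply: powR_cvg0; rewrite subr_gt0|exact: cvg_N_0].
move=> x x0 x1; have := f_gt0 x x0 x1; rewrite /f subr_gt0 => Nuv.
rewrite /rho weightD// -mulrA mulrCA ltr_pM2l ?weight_gt0//.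
by rewrite ltr_pdivlMr ?N_gt0// mulrC ltr_pdivrMr ?N_gt0.
Qed.

(** [N u] acts as an integrating factor: with it the Riccati terms combine into the product
    [(rho u - rho v) * (rho v + h - v)], signed by [rho_mono] and [rho_gt]. *)
Let rho_diff u v x : 0 < v -> v < u -> 0 < x -> x < 1 ->
  0 < (b - 1) * (u - v - (rho u x - rho v x)).
Proof.
move=> v0 vu; have u0 := lt_trans v0 vu; move: x.
pose f x := (b - 1) * ((u - v - (rho u x - rho v x)) * N u x).
have f_gt0 x : 0 < x -> x < 1 -> 0 < f x.
  apply: (is_derive_gt0_lt_at_right f
    (fun x => N u x * (rho u x - rho v x) *
              ((b - 1) * (rho v x + h x - v)) / x) 0 1 0).
  - move=> {}x x0 x1.
    apply: (is_derive_eq (is_deriveZ (b - 1) (is_deriveM (is_deriveB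
      (is_derive_cst (u - v) x 1) (is_deriveB (is_derive_rho u x u0 x0 x1)
      (is_derive_rho v x v0 x0 x1))) (is_derive_N u x u0 x0 x1)))).
    rewrite /= /GRing.scale/=.
    have -> : (cst (u - v) - (rho u - rho v)) x = u - v - (rho u x - rho v x) by [].
    move: (rho u x) (rho v x) (N u x) (h x) => ru rv n hx.
    by field; rewrite gt_eqF.
  - move=> {}x x0 x1; rewrite divr_gt0// mulr_gt0 ?rho_gt//.
    by rewrite mulr_gt0 ?N_gt0// subr_gt0 rho_mono.
  - have l0 : (b - 1) * ((u - v - (u - v)) * 0) = 0 by ring.
    rewrite -[X in _ --> X]l0; apply: cvgMr; apply: cvgM; last exact: cvg_N_0.
    apply: cvgB; first exact: cvg_cst.
    by apply: cvgB; exact: cvg_rho_0.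
move=> x x0 x1; have := f_gt0 x x0 x1.
by rewrite /f mulrA pmulr_lgt0// N_gt0.
Qed.

(* The factor [expR (- (p ln rho_u + q ln rho_v)) * N_w] integrates the linear
   differential equation satisfied by [p rho_u + q rho_v - rho_w]. *)
Let rho_convex u v p x : 0 < v -> v < u -> 0 < p -> p < 1 -> 0 < x -> x < 1 ->
  0 < (b - 1) * (p * rho u x + (1 - p) * rho v x - rho (p * u + (1 - p) * v) x).
Proof.
move=> v0 vu p0 p1; have u0 := lt_trans v0 vu.
have q0 : 0 < 1 - p by rewrite subr_gt0.
set w := p * u + (1 - p) * v.
have w0 : 0 < w by rewrite addr_gt0 ?mulr_gt0.
move: x.
pose gap x := p * rho u x + (1 - p) * rho v x - rho w x.
pose lnr x := p * ln (rho u x) + (1 - p) * ln (rho v x).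
pose fac x := expR (- lnr x) * N w x.
have fac_gt0 x : 0 < x -> x < 1 -> 0 < fac x.
  by move=> x0 x1; rewrite mulr_gt0 ?expR_gt0 ?N_gt0.
pose f x := (b - 1) * (gap x * fac x).
have f_gt0 x : 0 < x -> x < 1 -> 0 < f x.
  (* Under the weights [p] and [1 - p], the remaining source term is the covariance of the
     parameters [u, v] with [rho u, rho v], minus the variance of [rho u, rho v]. Hence the factor
     [p * (1 - p) * (rho u x - rho v x)]. *)
  apply: (is_derive_gt0_lt_at_right f
    (fun x => fac x * (p * (1 - p) * (rho u x - rho v x)) *
              ((b - 1) * (u - v - (rho u x - rho v x))) / x) 0 1 0).
  - move=> {}x x0 x1.
    have dlnrho a : 0 < a ->
        is_derive x 1 (fun y => ln (rho a y)) ((a - h x - rho a x) / x).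
      move=> a0; have r0 := rho_gt0 a x a0 x0 x1.
      have := is_derive1_comp (f := @ln R) (g := rho a) (is_derive1_ln r0)
        (is_derive_rho a x a0 x0 x1).
      by rewrite mulrA mulKf// gt_eqF.
    have dgap := is_deriveB (is_deriveD
      (is_deriveZ p (is_derive_rho u x u0 x0 x1))
      (is_deriveZ (1 - p) (is_derive_rho v x v0 x0 x1)))
      (is_derive_rho w x w0 x0 x1).
    have dlnr := is_deriveN (is_deriveD (is_deriveZ p (dlnrho u u0))
      (is_deriveZ (1 - p) (dlnrho v v0))).
    have dexp := is_derive1_comp (f := @expR R) (g := fun y => - lnr y)
      (is_derive_expR (- lnr x)) dlnr.
    apply: (is_derive_eq (is_deriveZ (b - 1) (is_deriveM dgap
      (is_deriveM dexp (is_derive_N w x w0 x0 x1))))).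
    rewrite /= /GRing.scale/= /fac.
    set e := expR _.
    have -> : (p \*: rho u + (1 - p) \*: rho v - rho w) x = gap x by [].
    have -> : ((expR \o (fun y => - lnr y)) * N w) x = e * N w x by [].
    rewrite /gap; move: (rho u x) (rho v x) (rho w x) (N w x) (h x) => ru rv rw n hx.
    by rewrite /w; field; rewrite gt_eqF.
  - move=> {}x x0 x1; rewrite divr_gt0// mulr_gt0 ?rho_diff//.
    by rewrite mulr_gt0 ?fac_gt0// !mulr_gt0// subr_gt0 rho_mono.
  (* The exponential has a finite limit because [rho u] and [rho v] tend to the positive numbers [u]
     and [v]; the factor [N w] then sends the product to 0. *)
  - have l0 : (b - 1) * ((p * u + (1 - p) * v - w) *
        (expR (- (p * ln u + (1 - p) * ln v)) * 0)) = 0 by rewrite !mulr0.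
    have cvg_lnrho a : 0 < a -> ln (rho a y) @[y --> 0^'+] --> ln a.
      move=> a0; apply: (cvg_comp _ _ (cvg_rho_0 a a0)).
      exact: continuous_ln.
    rewrite -[X in _ --> X]l0; apply: cvgMr; apply: cvgM.
      apply: cvgB; last exact: cvg_rho_0.
      by apply: cvgD; apply: cvgMr; exact: cvg_rho_0.
    apply: cvgM; last exact: cvg_N_0.
    apply: continuous_cvg; first exact: continuous_expR.
    by apply: cvgN; apply: cvgD; apply: cvgMr; exact: cvg_lnrho.
move=> x x0 x1; have := f_gt0 x x0 x1.
by rewrite /f mulrA pmulr_lgt0// fac_gt0.
Qed.

Let L x a := ln (normalized_incomplete_beta x a b).

Let ln_normalized_lt u v p x : 0 < v -> v < u -> 0 < p -> p < 1 ->
  0 < x -> x < 1 ->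
  0 < (b - 1) * (L x (p * u + (1 - p) * v) - (p * L x u + (1 - p) * L x v)).
Proof.
move=> v0 vu p0 p1 x0 x1; have u0 := lt_trans v0 vu.
have q0 : 0 < 1 - p by rewrite subr_gt0.
set w := p * u + (1 - p) * v.
have w0 : 0 < w by rewrite addr_gt0 ?mulr_gt0.
(* Abstracting [lN] keeps conversion from unfolding the integrals. *)
have [lN lNE] : exists lN : R -> R -> R, forall a y, lN a y = ln (N a y).
  by exists (fun a y => ln (N a y)).
have LE a : 0 < a -> L x a = lN a x - lN a 1.
  move=> a0; rewrite !lNE /L /normalized_incomplete_beta ln_div// posrE.
    exact: N_gt0.
  exact: incomplete_beta_gt0.
rewrite !LE//.
pose f y := (b - 1) * (p * lN u y + (1 - p) * lN v y - lN w y).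
(* Normalizing subtracts [lN a 1] from [lN a x], so the quantity to be shown positive is exactly
   [f 1 - f x]. *)
suff : f x < f 1 by rewrite /f; lra.
have dlN a (y : R) : 0 < a -> 0 < y -> y < 1 -> is_derive y 1 (lN a) (rho a y / y).
  move=> a0 y0 y1; have n0 := N_gt0 a y a0 y0 y1.
  have -> : lN a = @ln R \o N a by apply/funext => z; rewrite lNE.
  apply: (is_derive_eq (is_derive1_comp (is_derive1_ln n0)
    (is_derive_N a y a0 y0 y1))).
  by rewrite -mulrA mulKf// gt_eqF.
(* For [b < 1] the integrand is unbounded at 1, so the endpoint enters only through a left limit. *)
have cvg_lN a : 0 < a -> lN a y @[y --> 1^'-] --> lN a 1.
  move=> a0; rewrite lNE; under eq_fun do rewrite lNE.
  apply: (cvg_comp _ _ (cvg_incomplete_beta_1 a b a0 b_gt0)).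
  by apply: continuous_ln; exact: incomplete_beta_gt0.
apply: (is_derive_gt0_lt_at_left f (fun y => (b - 1) *
  (p * rho u y + (1 - p) * rho v y - rho w y) / y) 0 1 (f 1) _ _ _ x x0 x1).
- move=> y y0 y1.
  apply: (is_derive_eq (is_deriveZ (b - 1) (is_deriveB (is_deriveD
    (is_deriveZ p (dlN u y u0 y0 y1)) (is_deriveZ (1 - p) (dlN v y v0 y0 y1)))
    (dlN w y w0 y0 y1)))).
  rewrite /= /GRing.scale/=.
  by move: (rho u y) (rho v y) (rho w y) => *; ring.
- by move=> y y0 y1; rewrite divr_gt0// rho_convex.
- apply: cvgMr; apply: cvgB; last exact: cvg_lN.
  by apply: cvgD; apply: cvgMr; exact: cvg_lN.
Qed.

Lemma ln_normalized_incomplete_beta_gap u v p x : 0 < u -> 0 < v -> u != v ->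
  0 < p -> p < 1 -> 0 < x -> x < 1 ->
  0 < (b - 1) * (ln (normalized_incomplete_beta x (p * u + (1 - p) * v) b) -
    (p * ln (normalized_incomplete_beta x u b) +
     (1 - p) * ln (normalized_incomplete_beta x v b))).
Proof.
move=> u0 v0 uv p0 p1 x0 x1.
have [vu|uv'|/eqP] := ltgtP v u; last by rewrite eq_sym (negbTE uv).
  exact: ln_normalized_lt.
have q0 : 0 < 1 - p by lra.
have q1 : 1 - p < 1 by lra.
(* The case [u < v] follows by exchanging [u] with [v] and [p] with [1 - p]. *)
have swap (K : R -> R) : (b - 1) * (K (p * u + (1 - p) * v) -
      (p * K u + (1 - p) * K v)) =
    (b - 1) * (K ((1 - p) * v + (1 - (1 - p)) * u) -
      ((1 - p) * K v + (1 - (1 - p)) * K u)).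
  by rewrite subKr (addrC (p * u)) (addrC (p * K u)).
have := swap (L x); rewrite /L => ->.
exact: ln_normalized_lt.
Qed.

End incomplete_beta_log_derivative.

(** * The normalized function: positivity, the case [b = 1], and the three regimes of [b] *)

Lemma normalized_incomplete_beta_gt0 {R : realType} (x a b : R) :
  0 < a -> 0 < b -> 0 < x -> x < 1 -> 0 < normalized_incomplete_beta x a b.
Proof.
by move=> a0 b0 x0 x1; apply: divr_gt0; apply: incomplete_beta_gt0 => //; exact: ltW.
Qed.

Lemma normalized_incomplete_beta_b1 {R : realType} (x a : R) :
  0 < a -> 0 < x -> x < 1 -> normalized_incomplete_beta x a 1 = x `^ a.
Proof.
move=> a0 x0 x1; rewrite /normalized_incomplete_beta.
rewrite !incomplete_beta_b1// ?(ltW x1)// powR1 div1r invrK mulfVK//.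
by rewrite gt_eqF.
Qed.

Theorem theorem2 (R : realType) (x : R) (hx0 : 0 < x) (hx1 : x < 1) :
  [/\ forall b : R, 0 < b -> b < 1 ->
        strictly_log_convex_on `]0, +oo[
          (fun a => normalized_incomplete_beta x a b),
      (forall a : R, 0 < a -> normalized_incomplete_beta x a 1 = x `^ a) /\
        log_neutral_on `]0, +oo[
          (fun a => normalized_incomplete_beta x a 1)
    & forall b : R, 1 < b ->
        strictly_log_concave_on `]0, +oo[
          (fun a => normalized_incomplete_beta x a b)].
Proof.
have pos (u : R) : `]0, +oo[%classic u -> 0 < u by rewrite /= in_itv/= andbT.
have ppos b : 0 < b ->
    positive_on `]0, +oo[ (fun a => normalized_incomplete_beta x a b).
  by move=> b0 u /pos u0; exact: normalized_incomplete_beta_gt0.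
split.
- move=> b b0 b1; split; first exact: ppos.
  move=> u v p /pos u0 /pos v0 uv p0 p1.
  have := ln_normalized_incomplete_beta_gap b b0 (negbT (lt_eqF b1)) u v p x
    u0 v0 uv p0 p1 hx0 hx1.
  (* Dividing by [b - 1 < 0] reverses the gap inequality, which turns concavity into convexity. *)
  by rewrite nmulr_rgt0 ?subr_lt0.
- split; first by move=> a a0; exact: normalized_incomplete_beta_b1.
  split; first exact: ppos.
  exists (ln x), 0 => u /pos u0.
  by rewrite normalized_incomplete_beta_b1// ln_powR mulrC addr0.
- move=> b b1; have b0 : 0 < b := lt_trans ltr01 b1.
  split; first exact: ppos.
  move=> u v p /pos u0 /pos v0 uv p0 p1.
  have := ln_normalized_incomplete_beta_gap b b0 (negbT (gt_eqF b1)) u v p x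
    u0 v0 uv p0 p1 hx0 hx1.
  by rewrite pmulr_rgt0 ?subr_gt0.
Qed.
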